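(* Let $G_\lambda$ be the spider on $n$ nodes with center node of degree $k$ and corresponding partition $\lambda=(\lambda_1,\ldots,\lambda_k)$ of $n-1$ into $k$ parts. If $\lambda$ has $\ell$ parts of size one, then $$M(G_\lambda;x)=\sum_{j=0}^{k-\ell}\left(\sum_{S\in\binom{[k-\ell]}{j}}L(S;x)\right)x^j\,M(G_1(k-j);x).$$
   Context: A DAG with skeleton $G$ (a finite simple undirected graph) is an acyclic orientation of all edges of $G$. An immorality in a DAG is an induced subgraph $i\to j\leftarrow k$ (so $i,k$ are nonadjacent). Two DAGs are Markov equivalent iff they have the same skeleton and the same set of immoralities; a Markov equivalence class (MEC) with skeleton $G$ is an equivalence class of DAGs with skeleton $G$, and all its members have the same immoralities. $m_k(G)$ is the number of MECs with skeleton $G$ having exactly $k$ immoralities, and $M(G;x)=\sum_{k\ge0}m_k(G)x^k$. A spider is a tree with precisely one node (the center) of degree greater than two. If the center has degree $k$, the spider on $n$ nodes corresponds to a partition $\lambda=(\lambda_1,\ldots,\lambda_k)$ of $n-1$ with $\lambda_1\ge\cdots\ge\lambda_k>0$, where $\lambda_i$ is the number of vertices on the $i$-th leg; that is, $G_\lambda$ consists of a center vertex joined to one endpoint of each of $k$ disjoint paths with $\lambda_1,\ldots,\lambda_k$ vertices. $I_q$ is the path with $q$ vertices. $G_1(q)$ is the $q$-star: a center vertex joined to $q$ leaves ($G_1(0)$ is a single vertex). $[r]=\{1,\ldots,r\}$ and $\binom{[r]}{j}$ is the set of $j$-element subsets of $[r]$. For $S\subset[k]$, $$L(S;x)=\left(\prod_{i\in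 S}M(I_{\lambda_i-1};x)\right)\left(\prod_{i\in[k]\setminus S}M(I_{\lambda_i};x)\right).$$ *)

(* Defs.v *)
From mathcomp Require Import all_boot all_order all_algebra.
Set Implicit Arguments.
Unset Strict Implicit.
Unset Printing Implicit Defensive.
Import GRing.Theory.

Record sgraph := SGraph {
  svertex : finType;
  sedge : rel svertex;
  sedge_sym : symmetric sedge;
  sedge_irr : irreflexive sedge
}.

Section MarkovEquivalence.
Variable T : finType.
(* A digraph on T is the set of its arcs; (u, v) stands for u -> v. *)
Implicit Types D : {set T * T}.

Definition darc D : rel T := [rel u v | (u, v) \in D].

(* No arc u -> v is closed up by a directed path from v back to u.  As
   [connect] is reflexive this excludes loops, and it excludes 2-cycles, so an
   acyclic digraph orients each edge of its skeleton in exactly one way. *)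
Definition acyclic D : bool :=
  [forall u, forall v, darc D u v ==> ~~ connect (darc D) v u].

Definition skeleton D : {set T * T} :=
  [set p | darc D p.1 p.2 || darc D p.2 p.1].

Definition is_immorality D (i j k : T) : bool :=
  [&& i != k, darc D i j, darc D k j & (i, k) \notin skeleton D].

(* i -> j <- k is recorded as ({i, k}, j): it is the same immorality as
   k -> j <- i and must be counted once. *)
Definition immoralities D : {set {set T} * T} :=
  [set ([set t.1.1; t.2], t.1.2)
    | t : T * T * T & is_immorality D t.1.1 t.1.2 t.2].

Definition markov_equiv : rel {set T * T} :=
  [rel D D' | (skeleton D == skeleton D')
              && (immoralities D == immoralities D')].

End MarkovEquivalence.

Definition dags (G : sgraph) : {set {set svertex G * svertex G}} :=
  [set D | acyclic D & skeleton D == [set p | sedge p.1 p.2]].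

Definition mecs (G : sgraph) : {set {set {set svertex G * svertex G}}} :=
  equivalence_partition (@markov_equiv _) (dags G).

(* m_k(G) *)
Definition num_mecs (G : sgraph) (k : nat) : nat :=
  #|[set C in mecs G | [forall D in C, #|immoralities D| == k]]|.

(* M(G; x).  The cutoff discards only zero terms, see [coef_mec_poly]. *)
Definition mec_poly (G : sgraph) : {poly int} :=
  \poly_(k < #|{: {set svertex G} * svertex G}|.+1) (num_mecs G k)%:R%R.

Lemma coef_mec_poly (G : sgraph) (k : nat) :
  ((mec_poly G)`_k = (num_mecs G k)%:R)%R.
Proof.
rewrite coef_poly ltnS; case: leqP => // ltNk; rewrite /num_mecs.
rewrite (_ : [set C in _ | _] = set0) ?cards0 //; apply/setP => C.
rewrite in_set0; apply/negP; rewrite inE.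
case/andP => /imsetP[D DG ->] /forall_inP/(_ D).
rewrite inE DG /markov_equiv /= !eqxx => /(_ isT)/eqP kE.
by move: ltNk; rewrite -kE ltnNge max_card.
Qed.

Definition consecutive : rel nat := [rel a b | (a.+1 == b) || (b.+1 == a)].

Lemma consecutive_sym : symmetric consecutive.
Proof. by move=> a b; rewrite /consecutive /= orbC. Qed.

Lemma consecutive_irr : irreflexive consecutive.
Proof. by move=> a; rewrite /consecutive /= orbb eqn_leq ltnn. Qed.

(* I_q *)
Definition path_graph (q : nat) : sgraph :=
  @SGraph 'I_q (fun a b => consecutive a b)
    (fun a b => consecutive_sym a b) (fun a => consecutive_irr a).

Definition star_edge (q : nat) : rel (option 'I_q) :=
  [rel u v | (u == None) (+) (v == None)].

Lemma star_edge_sym q : symmetric (@star_edge q).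
Proof. by move=> u v; rewrite /star_edge /= addbC. Qed.

Lemma star_edge_irr q : irreflexive (@star_edge q).
Proof. by move=> u; rewrite /star_edge /= addbb. Qed.

(* G_1(q), with center None *)
Definition star_graph (q : nat) : sgraph :=
  SGraph (@star_edge_sym q) (@star_edge_irr q).

Definition is_partition (k : nat) (lam : 'I_k -> nat) (m : nat) : Prop :=
  [/\ forall i j : 'I_k, i <= j -> lam j <= lam i,
      forall i, 0 < lam i
    & \sum_(i < k) lam i = m].

Section Spider.
Variables (k : nat) (lam : 'I_k -> nat).

(* None is the center; the pair of i and a is the vertex at distance a + 1
   from the center on leg i. *)
Definition spider_edge : rel (option {i : 'I_k & 'I_(lam i)}) :=
  fun u v => match u, v with
  | None, None => false
  | None, Some y => tagged y == 0 :> nat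
  | Some x, None => tagged x == 0 :> nat
  | Some x, Some y => (tag x == tag y) && consecutive (tagged x) (tagged y)
  end.

Lemma spider_edge_sym : symmetric spider_edge.
Proof. by move=> [x|] [y|] //=; rewrite eq_sym consecutive_sym. Qed.

Lemma spider_edge_irr : irreflexive spider_edge.
Proof. by move=> [x|] //=; rewrite consecutive_irr andbF. Qed.

Definition spider : sgraph := SGraph spider_edge_sym spider_edge_irr.

Definition L (S : {set 'I_k}) : {poly int} :=
  ((\prod_(i in S) mec_poly (path_graph (lam i - 1)))
   * \prod_(i in ~: S) mec_poly (path_graph (lam i)))%R.

End Spider.

(* Main.v *)
Require Import Defs.
From mathcomp Require Import all_boot all_order all_algebra zify.
Set Implicit Arguments.
Unset Strict Implicit.
Unset Printing Implicit Defensive.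
Import GRing.Theory.

(** In a triangle-free graph any two parents of a vertex are nonadjacent, so
the immoralities at v are exactly the pairs of parents of v.  A Markov
equivalence class is therefore the same thing as a function that sends each
vertex having at least two parents to its set of parents and every other
vertex to the empty set, and M(G; x) is the sum, over the functions f that
come from a DAG, of x to the number of pairs contained in the sets f v
([mec_poly_immoralities], [mec_poly_code]).

In a spider every vertex except the center has degree at most two, so it is
a collider exactly when both its edges point to it.  The function is thus
given by the set P of the legs that point to the center, when there are at
least two of them, together with the set A_i of colliders on each leg i.
The constraints are local: no two colliders are adjacent, the last vertex of a
leg is no collider, and the first vertex of leg i is no collider if i is in P.
They are also sufficient: orienting all edges by an explicit rank
([code_rank]) realizes any such P and A_i.  Hence M(spider) is a sum over P of
products over the legs ([mec_poly_spider]).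

It remains to group the terms by the set S of the legs whose first vertex is
a collider.  Such a leg has at least two vertices and is not in P; removing
its first vertex turns the rest into an arbitrary collider set of a path with
one vertex less, which gives x M(I_(lam_i - 1)).  A leg outside S contributes
M(I_(lam_i)).  The remaining sum over P contained in the complement of S is the
polynomial of a star on the legs outside S.  Both the path (one leg attached
to an end vertex) and the star (all legs of size one) are themselves spiders in
the sense of [spider], so the same formula evaluates them
([mec_poly_path], [mec_poly_star]). *)

(** * Markov equivalence classes of triangle-free graphs *)

Section Signatures.
Variable G : sgraph.
Local Notation T := (svertex G).
Implicit Types (r : T -> nat) (D : {set T * T}) (f : {ffun T -> {set T}}).

(** A rank stands for the DAG that orients each edge towards its higher end: such
an orientation is acyclic by construction, and every DAG arises in this way. *)
Definition proper_rank r := forall u v, sedge u v -> r u != r v.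

Definition rank_orient r : {set T * T} :=
  [set p | sedge p.1 p.2 && (r p.1 < r p.2)].

Definition parents D v : {set T} := [set u | darc D u v].

Definition colliding D v : {set T} :=
  if 1 < #|parents D v| then parents D v else set0.

Definition signature D : {ffun T -> {set T}} := [ffun v => colliding D v].

Lemma darc_rank r u v :
  darc (rank_orient r) u v = sedge u v && (r u < r v).
Proof. by rewrite /darc /rank_orient /= inE. Qed.

Lemma rank_orient_dag r : proper_rank r -> rank_orient r \in dags G.
Proof.
move=> pr; rewrite inE; apply/andP; split.
  apply/forallP => u; apply/forallP => v; apply/implyP.
  rewrite darc_rank => /andP[_ ltuv].
  suff le_con x y : connect (darc (rank_orient r)) x y -> r x <= r y.
    by apply/negP => /le_con; rewrite leqNgt ltuv.
  case/connectP => p; elim: p x => [|z p IH] x; first by move=> _ ->.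
  rewrite [path _ _ _]/= darc_rank => /andP[/andP[_ /ltnW lexz] pz] yE.
  exact: leq_trans lexz (IH _ pz yE).
apply/eqP/setP => -[u v]; rewrite !inE !darc_rank.
rewrite [sedge v u]sedge_sym -andb_orr -neq_ltn.
by case E: (sedge u v) => //=; apply: pr.
Qed.

(** The number of ancestors is a rank that induces the given DAG. *)
Lemma dag_rank D : D \in dags G -> exists2 r, proper_rank r & D = rank_orient r.
Proof.
rewrite inE => /andP[/forallP acyc /eqP skel].
have arcE u v : sedge u v = darc D u v || darc D v u.
  by have /setP/(_ (u, v)) := skel; rewrite !inE.
pose anc v := [set u | connect (darc D) u v].
have lt_anc u v : darc D u v -> #|anc u| < #|anc v|.
  move=> uv; apply: proper_card; apply/properP; split.
    by apply/subsetP => w; rewrite !inE => /connect_trans; apply; apply: connect1.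
  exists v; rewrite !inE ?connect0 //.
  by have /forallP/(_ v)/implyP/(_ uv) := acyc u.
exists (fun v => #|anc v|).
  move=> u v; rewrite arcE neq_ltn => /orP[] /lt_anc -> //; exact: orbT.
apply/setP => -[u v]; rewrite inE /=; apply/idP/andP => [uv|[]].
  by rewrite arcE (lt_anc u v uv) [darc D u v]uv.
by rewrite arcE => /orP[//|/lt_anc/ltnW]; rewrite leqNgt => /negP.
Qed.

(** The immoralities that a function f would have as its signature. *)
Definition pair_set f : {set {set T} * T} :=
  [set p : {set T} * T | (p.1 \subset f p.2) && (#|p.1| == 2)].

Definition triangle_free :=
  forall u v w : T, sedge u v -> sedge u w -> ~~ sedge v w.

(** Without triangles, two parents of a vertex are never adjacent, so each pair
of parents is an immorality. *)
Lemma immoralities_signature D : triangle_free -> D \in dags G ->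
  immoralities D = pair_set (signature D).
Proof.
move=> tf DG.
have skel u v : ((u, v) \in skeleton D) = sedge u v.
  by move: DG; rewrite inE => /andP[_ /eqP ->]; rewrite inE.
have arc_edge u v : darc D u v -> sedge v u.
  by move=> uv; rewrite -skel inE /= [darc D u v]uv orbT.
apply/setP => -[B v]; rewrite [in RHS]inE /= ffunE; apply/imsetP/andP.
  case=> -[[i j] w] /=; rewrite inE /= => /and4P[iw ij wj _] [-> ->].
  rewrite cards2 iw; split=> //.
  have sub : [set i; w] \subset parents D j.
    by apply/subsetP => x; rewrite !inE => /orP[] /eqP ->.
  rewrite /colliding; case: ltnP => // /(leq_trans (subset_leq_card sub)).
  by rewrite cards2 iw.
case=> sub /cards2P[i [w [iw BE]]]; move: sub; rewrite {}BE => sub.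
have subp : [set i; w] \subset parents D v.
  by move: sub; rewrite /colliding; case: ifP => // _ /subset_trans; apply; apply: sub0set.
have iv : darc D i v by have := subsetP subp i; rewrite !inE eqxx; apply.
have wv : darc D w v by have := subsetP subp w; rewrite !inE eqxx orbT; apply.
exists ((i, v), w) => //; rewrite inE; apply/and4P; split=> //.
by rewrite skel (tf v) ?arc_edge.
Qed.

Lemma card_colliding D v : #|colliding D v| != 1.
Proof. by rewrite /colliding; case: ltnP; rewrite ?cards0 // => /ltn_eqF; rewrite eq_sym => ->. Qed.

Lemma pair_set_sub f (g : {ffun T -> {set T}}) : (forall v, #|f v| != 1) ->
  pair_set f = pair_set g -> forall v, f v \subset g v.
Proof.
move=> f1 fg v; apply/subsetP => x xf.
have /card_gt1P[y [z [yf zf yz]]] : 1 < #|f v|.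
  by rewrite ltn_neqAle eq_sym f1; apply/card_gt0P; exists x.
have [w wf xw] : exists2 w, w \in f v & x != w.
  by case: (eqVneq x y) => [->|]; [exists z | exists y].
have : ([set x; w], v) \in pair_set f.
  rewrite inE /= cards2 xw andbT.
  by apply/subsetP => u; rewrite !inE => /orP[] /eqP ->.
rewrite fg inE /= => /andP[/subsetP/(_ x) + _]; rewrite !inE eqxx; exact.
Qed.

(** A set that is not a singleton is the union of its two-element subsets;
singletons, which contain no pair, are what has to be excluded. *)
Lemma pair_set_inj f (g : {ffun T -> {set T}}) :
    (forall v, #|f v| != 1) -> (forall v, #|g v| != 1) ->
  pair_set f = pair_set g -> f = g.
Proof.
move=> f1 g1 fg; apply/ffunP => v; apply/eqP.
by rewrite eqEsubset !pair_set_sub.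
Qed.

Lemma card_pair_set f : #|pair_set f| = \sum_v 'C(#|f v|, 2).
Proof.
rewrite -sum1_card (partition_big (fun p : {set T} * T => p.2) xpredT) //=.
apply: eq_bigr => v _; rewrite -cards_draws -sum1_card.
rewrite (reindex_onto (fun B => (B, v)) (fun p : {set T} * T => p.1)) /=.
  by apply: eq_bigl => B; rewrite !inE /= !eqxx !andbT.
by case=> B w /andP[_ /eqP /= ->].
Qed.

Local Open Scope ring_scope.

(** All DAGs of G share their skeleton, so a class is determined by its set of
immoralities. *)
Lemma mec_poly_immoralities : mec_poly G =
  \sum_(I in @immoralities T @: dags G) 'X^#|I|.
Proof.
apply/polyP => k; rewrite coef_mec_poly coef_sum /num_mecs.
pose cls I := [set D in dags G | immoralities D == I].
have skelE D E : D \in dags G -> E \in dags G -> skeleton D = skeleton E.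
  by rewrite !inE => /andP[_ /eqP ->] /andP[_ /eqP ->].
have clsE D : D \in dags G ->
    [set E in dags G | markov_equiv D E] = cls (immoralities D).
  move=> DG; apply/setP => E; rewrite [LHS]in_set [RHS]in_set; case EG: (E \in dags G) => //=.
  by rewrite /markov_equiv /= (skelE D E) // eqxx eq_sym.
have -> : [set C in mecs G | [forall D in C, #|immoralities D| == k]] =
    cls @: [set I in @immoralities T @: dags G | #|I| == k].
  apply/setP => C; rewrite inE; apply/andP/imsetP.
    case=> /imsetP[D DG ->] /forall_inP all_k; exists (immoralities D).
      rewrite inE imset_f //= all_k // clsE // inE DG /=; exact: eqxx.
    exact: clsE.
  case=> I; rewrite inE => /andP[/imsetP[D DG ->] kE] ->; split.
    by apply/imsetP; exists D; rewrite ?clsE.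
  by apply/forall_inP => E; rewrite inE => /andP[_ /eqP ->].
rewrite card_in_imset => [|I J]; last first.
  rewrite !inE => /andP[/imsetP[D DG ->] _] /andP[_ _] /setP/(_ D).
  by rewrite in_set DG in_set DG eqxx /= => /esym/eqP.
rewrite -sum1_card natr_sum big_mkcond [RHS]big_mkcond /=.
apply: eq_bigr => I _; rewrite inE coefXn eq_sym.
by case: (I \in _); case: eqP.
Qed.

(** The tool for computing M(G; x): an injective parametrization enc of the
signatures that occur may replace the classes as the index set of the sum. *)
Lemma mec_poly_code (C : finType) (valid : pred C) (enc : C -> T -> {set T}) :
    triangle_free ->
    {in valid &, forall c c', enc c =1 enc c' -> c = c'} ->
    (forall r, proper_rank r ->
       exists2 c, valid c & colliding (rank_orient r) =1 enc c) ->
    (forall c, valid c ->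
       exists2 r, proper_rank r & colliding (rank_orient r) =1 enc c) ->
  mec_poly G = \sum_(c | valid c) 'X^(\sum_v 'C(#|enc c v|, 2)).
Proof.
move=> tf inj complete realized.
pose imm c := pair_set (finfun (enc c)).
have immE r c : proper_rank r -> colliding (rank_orient r) =1 enc c ->
    immoralities (rank_orient r) = imm c.
  move=> pr rc; rewrite immoralities_signature ?rank_orient_dag //.
  by congr pair_set; apply/ffunP => v; rewrite !ffunE rc.
have -> : mec_poly G = \sum_(I in imm @: [set c | valid c]) 'X^#|I|.
  rewrite mec_poly_immoralities; apply: eq_bigl => I.
  apply/imsetP/imsetP => [[D /dag_rank[r pr ->] ->]|[c]].
    have [c vc rc] := complete r pr.
    by exists c; rewrite ?inE //; apply: immE.
  rewrite inE => /realized[r pr rc] ->.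
  by exists (rank_orient r); rewrite ?rank_orient_dag // (immE r c).
rewrite big_imset => [|c c'] /=.
  apply: eq_big => c; rewrite ?inE // => _.
  by rewrite card_pair_set; congr 'X^_; apply: eq_bigr => v _; rewrite ffunE.
have enc1 d : valid d -> forall v, #|finfun (enc d) v| != 1%N.
  by move=> /realized[r pr rd] v; rewrite ffunE -rd card_colliding.
rewrite !inE => vc vc' /pair_set_inj cc'; apply: inj => // v.
by have /ffunP/(_ v) := cc' (enc1 _ vc) (enc1 _ vc'); rewrite !ffunE.
Qed.

End Signatures.

(** * Invariance under isomorphism *)

Lemma parents_rank (G : sgraph) (r : svertex G -> nat) u v :
  (u \in parents (rank_orient r) v) = sedge u v && (r u < r v).
Proof. by rewrite inE darc_rank. Qed.

(** Signatures are transported along the isomorphism by pulling back ranks. *)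
Lemma mec_poly_iso (G H : sgraph) (phi : svertex G -> svertex H) :
    triangle_free H -> bijective phi ->
    (forall u v, sedge u v = sedge (phi u) (phi v)) ->
  mec_poly G = mec_poly H.
Proof.
move=> tfH bij_phi edgeE; have [psi phiK psiK] := bij_phi.
have card_phi (B : {set svertex H}) : #|phi @^-1: B| = #|B|.
  exact/on_card_preimset/onW_bij.
have tfG : triangle_free G.
  by move=> u v w; rewrite !edgeE; apply: tfH.
have pullback (r : svertex H -> nat) v :
    colliding (rank_orient (r \o phi)) v =
    phi @^-1: colliding (rank_orient r) (phi v).
  have parE : parents (rank_orient (r \o phi)) v =
      phi @^-1: parents (rank_orient r) (phi v).
    by apply/setP => u; rewrite [RHS]inE !parents_rank edgeE.
  rewrite /colliding parE card_phi; case: ifP => // _.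
  by apply/setP => u; rewrite !inE.
pose valid f := f \in @signature H @: dags H.
have realized f : valid f ->
    exists2 r, proper_rank r & colliding (rank_orient r) =1 f.
  by case/imsetP=> D /dag_rank[r pr ->] ->; exists r => // v; rewrite ffunE.
have complete r : proper_rank r ->
    exists2 f, valid f & colliding (rank_orient r) =1 f.
  move=> pr; exists (signature (rank_orient r)).
    exact/imset_f/rank_orient_dag.
  by move=> v; rewrite ffunE.
rewrite (@mec_poly_code H _ valid (fun f => f)) //; last first.
  by move=> f g _ _ fg; apply/ffunP.
rewrite (@mec_poly_code G _ valid (fun f v => phi @^-1: f (phi v))) //.
- apply: eq_bigr => f _; congr ('X^_)%R.
  rewrite (reindex phi) /=; last exact/onW_bij.
  by apply: eq_bigr => v _; rewrite card_phi.
- move=> f g _ _ fg; apply/ffunP => w; apply/setP => x.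
  by have /setP/(_ (psi x)) := fg (psi w); rewrite !inE !psiK.
- move=> r pr; have [|f vf rf] := complete (r \o psi).
    by move=> u v uv /=; apply: pr; rewrite edgeE !psiK.
  exists f => // v; rewrite -rf -pullback.
  have -> // : rank_orient r = rank_orient ((r \o psi) \o phi).
  by apply/setP => -[x y]; rewrite !inE /= !phiK.
- move=> f /realized[r pr rf]; exists (r \o phi).
    by move=> u v; rewrite edgeE; apply: pr.
  by move=> v; rewrite pullback rf.
Qed.

(** * Collider patterns of a spider *)

Section SpiderCodes.
Variables (k : nat) (lam : 'I_k -> nat).
Local Notation leg_vertex := {i : 'I_k & 'I_(lam i)}.
Implicit Types (x y z : leg_vertex) (u v w : option leg_vertex).

(** Heights of adjacent vertices differ by one, and the neighbors of a leg vertex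
have distinct heights.  This gives at once that there are no triangles and that
a leg vertex has at most two neighbors. *)
Definition height v := if v is Some x then (tagged x).+1 else 0.

Definition at_leg i a (lt_a : a < lam i) : leg_vertex :=
  Tagged (fun i => 'I_(lam i)) (Ordinal lt_a).

Lemma leg_vertex_eq x y : tag x = tag y -> tagged x = tagged y :> nat -> x = y.
Proof.
case: x y => [i a] [j b] /= ij; case: j / ij b => b ab.
by congr (existT _ _ _); apply: val_inj.
Qed.

Lemma edge_height u v : spider_edge u v ->
  (height u).+1 = height v \/ (height v).+1 = height u.
Proof.
case: u v => [x|] [y|] //=; first by case/andP => _ /orP[] /eqP ->; [left|right].
  by move/eqP->; right.
by move/eqP->; left.
Qed.

(** Heights alternate in parity along edges. *)
Lemma spider_triangle_free : triangle_free (spider lam).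
Proof.
move=> u v w /edge_height uv /edge_height uw; apply/negP => /edge_height vw.
by lia.
Qed.

Lemma nbr_height_inj x u w : spider_edge (Some x) u -> spider_edge (Some x) w ->
  height u = height w -> u = w.
Proof.
case: u w => [y|] [z|] //= /andP[/eqP xy _] /andP[/eqP xz _] [yz].
by congr Some; apply: leg_vertex_eq; rewrite -?xy.
Qed.

Lemma prev_nbr x : exists2 u, spider_edge (Some x) u & (height u).+1 = height (Some x).
Proof.
case: x => i [[|a] lt_a]; first by exists None.
exists (Some (at_leg (ltnW lt_a))) => //=.
by rewrite /consecutive /= !eqxx orbT.
Qed.

Lemma next_nbr x : (tagged x).+1 < lam (tag x) ->
  exists2 y, spider_edge (Some x) (Some y) & tagged y = (tagged x).+1 :> nat.
Proof.
move=> lt_x; exists (at_leg lt_x) => //=.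
by rewrite /consecutive /= !eqxx.
Qed.

Lemma nbr_above x u : spider_edge (Some x) u -> height u = (height (Some x)).+1 ->
  (tagged x).+1 < lam (tag x).
Proof.
case: u => //= y /andP[/eqP xy _] [yx]; rewrite -yx xy; exact: ltn_ord.
Qed.

Lemma two_nbrs x u v w : spider_edge (Some x) u -> spider_edge (Some x) v ->
  u != v -> spider_edge (Some x) w -> (w == u) || (w == v).
Proof.
move=> xu xv /eqP uv xw.
have [/(nbr_height_inj xw xu) ->|wu] := eqVneq (height w) (height u).
  by rewrite eqxx.
have [/(nbr_height_inj xw xv) ->|wv] := eqVneq (height w) (height v).
  by rewrite eqxx orbT.
have [/(nbr_height_inj xu xv) //|uv'] := eqVneq (height u) (height v).
by case: (edge_height xu) (edge_height xv) (edge_height xw); lia.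
Qed.

Lemma card_nbrs x : (tagged x).+1 < lam (tag x) ->
  #|[set u | spider_edge (Some x) u]| = 2.
Proof.
case/next_nbr => y xy yE; have [u xu uE] := prev_nbr x.
have uy : u != Some y by apply/eqP => uE'; move: uE; rewrite uE' /= yE; lia.
transitivity #|[set u; Some y]|; last by rewrite cards2 uy.
congr #|pred_of_set _|; apply/setP => w; rewrite !inE; apply/idP/orP.
  by move=> xw; apply/orP/(two_nbrs xu xy).
by case=> /eqP ->.
Qed.

Lemma parents_spider (r : option leg_vertex -> nat) u v :
  (u \in @parents (spider lam) (@rank_orient (spider lam) r) v) =
  spider_edge v u && (r u < r v).
Proof. by rewrite (@parents_rank (spider lam)) /= spider_edge_sym. Qed.

(** Since a leg vertex has at most two neighbors, two parents exhaust them; in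
particular it cannot be the last vertex of its leg. *)
Lemma parents_full (r : option leg_vertex -> nat) x :
  let p := @parents (spider lam) (@rank_orient (spider lam) r) (Some x) in
  1 < #|p| ->
  ((tagged x).+1 < lam (tag x)) /\ (p = [set u | spider_edge (Some x) u]).
Proof.
move=> p /card_gt1P[u [v []]]; rewrite !parents_spider.
move=> /andP[xu ru] /andP[xv rv] uv; split.
  have [hu|hu] := edge_height xu; first exact: nbr_above xu (esym hu).
  have [hv|hv] := edge_height xv; first exact: nbr_above xv (esym hv).
  by move/eqP: uv; case; apply: nbr_height_inj xu xv _; lia.
apply/setP => w; rewrite parents_spider [RHS]in_set.
case xw: (spider_edge _ _) => //=.
by case/orP: (two_nbrs xu xv uv xw) => /eqP ->; rewrite ?ru ?rv.
Qed.

Variable m : nat.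
Hypothesis le_lam : forall i, lam i <= m.+1.
(* All legs use the same ambient type of positions, whatever their sizes, so
   that a family of collider sets is a plain finite function and products over
   the legs distribute over sums. *)
Local Notation code := ({set 'I_k} * {ffun 'I_k -> {set 'I_m.+1}})%type.
Implicit Type c : code.

(** The collider sets that a leg with q vertices allows, a being the position
counted from the center: the last vertex has a single neighbor, and of two
adjacent vertices only one can be the head of the arc between them. *)
Definition leg_code (q : nat) (A : {set 'I_m.+1}) : bool :=
  [forall a in A, (a.+1 < q) && [forall b in A, b != a.+1 :> nat]].

(** [c.1] is the set of the legs that point to the center.  It is empty, not a
singleton, when the center is no collider.  A leg without vertices, as it occurs
when a single vertex is regarded as a spider, cannot point to the center. *)
Definition spider_code c : bool :=
  [&& #|c.1| != 1, c.1 \subset [set i | 0 < lam i]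
    & [forall i, leg_code (lam i) (c.2 i) && ((i \in c.1) ==> (ord0 \notin c.2 i))]].

Definition collider_at c x : bool := inord (tagged x) \in c.2 (tag x).

Definition code_parents c v : {set option leg_vertex} :=
  if v is Some x then
    if collider_at c x then [set u | spider_edge (Some x) u] else set0
  else [set Some x | x : leg_vertex & (tagged x == 0 :> nat) && (tag x \in c.1)].

(** Along a leg the rank grows with the distance to the center, except that a
collider is lifted by 2, which puts it above both its neighbors; a leg that does not point to
the center is lifted by 2 as a whole, so that it starts above the rank 1 of the
center.  As all lifts are even, adjacent vertices have ranks of different
parity. *)
Definition code_rank c v : nat :=
  if v is Some x then tagged x + 2 * collider_at c x + 2 * (tag x \notin c.1) else 1.

Lemma leg_codeP q (A : {set 'I_m.+1}) :
  reflect (forall a, a \in A -> a.+1 < q /\ forall b, b \in A -> b <> a.+1 :> nat)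
          (leg_code q A).
Proof.
apply: (iffP forall_inP) => [ok a /ok/andP[ltq /forall_inP nb]|ok a /ok[ltq nb]].
  by split=> // b /nb/eqP.
by rewrite ltq; apply/forall_inP => b /nb/eqP.
Qed.

Lemma inord_tagged x : (inord (tagged x) : 'I_m.+1) = tagged x :> nat.
Proof. by rewrite inordK // (leq_trans (ltn_ord _)). Qed.

Lemma spider_code_leg c : spider_code c -> forall i, leg_code (lam i) (c.2 i).
Proof. by case/and3P => _ _ /forallP ok i; case/andP: (ok i). Qed.

Lemma collider_next c x : spider_code c -> collider_at c x -> (tagged x).+1 < lam (tag x).
Proof.
by move/spider_code_leg/(_ (tag x))/leg_codeP => ok /ok[]; rewrite inord_tagged.
Qed.

Lemma collider_apart c x y : spider_code c -> collider_at c x -> tag x = tag y ->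
  tagged y = (tagged x).+1 :> nat -> ~~ collider_at c y.
Proof.
move/spider_code_leg/(_ (tag x))/leg_codeP => ok /ok[_ nb] xy yE.
move: (inord_tagged y); rewrite /collider_at; move: (inord (tagged y)) => b bE; rewrite -xy.
by apply/negP => /nb; rewrite inord_tagged bE.
Qed.

Lemma collider_root c x : spider_code c -> tag x \in c.1 -> tagged x = 0 :> nat ->
  ~~ collider_at c x.
Proof.
case/and3P => _ _ /forallP/(_ (tag x))/andP[_ /implyP ok] /ok + x0.
rewrite /collider_at; suff -> : inord (tagged x) = ord0 :> 'I_m.+1 by [].
by apply: val_inj; rewrite /= inord_tagged x0.
Qed.

Lemma card_center_parents c : c.1 \subset [set i | 0 < lam i] ->
  #|code_parents c None| = #|c.1|.
Proof.
move=> /subsetP pos; rewrite card_imset; last exact: Some_inj.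
rewrite -(@card_in_imset _ _ (@tag _ _) [set x : leg_vertex | _]); last first.
  move=> x y; rewrite !inE => /andP[/eqP x0 _] /andP[/eqP y0 _] xy.
  by apply: leg_vertex_eq => //; rewrite x0 y0.
congr #|pred_of_set _|; apply/setP => i; apply/imsetP/idP => [[x]|iP].
  by rewrite inE => /andP[_ xP] ->.
have := pos i iP; rewrite inE => lam_i.
by exists (at_leg lam_i); rewrite ?inE.
Qed.

Lemma same_side c x y : tag x = tag y -> (tag x \in c.1) = (tag y \in c.1).
Proof. by move->. Qed.

Lemma code_rank_proper c : @proper_rank (spider lam) (code_rank c).
Proof.
move=> [x|] [y|] //=; last 2 first.
- by move/eqP ->; lia.
- by move/eqP ->; lia.
by case/andP=> /eqP/same_side -> /orP[] /eqP; lia.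
Qed.

(** A recorded collider lies above all its neighbors; any other leg vertex lies
below its outer neighbor, which leaves it at most one parent. *)
Lemma parents_code c : spider_code c ->
  @colliding (spider lam) (@rank_orient (spider lam) (code_rank c)) =1 code_parents c.
Proof.
move=> ok [x|]; last first.
  have parE : @parents (spider lam)
      (@rank_orient (spider lam) (code_rank c)) None = code_parents c None.
    apply/setP => -[y|]; rewrite parents_spider /=; last first.
      by apply/esym/negbTE/imsetP => -[].
    rewrite mem_imset; last exact: Some_inj.
    rewrite inE; case: eqP => //= y0; rewrite y0.
    case yP: (tag y \in c.1); last by lia.
    by rewrite (negbTE (collider_root ok yP y0)).
  case/and3P: (ok) => P1 pos _.
  rewrite /colliding parE; case: ltnP => //.
  rewrite card_center_parents // => P_le1; apply/esym/eqP.
  by rewrite -cards_eq0 card_center_parents //; case: #|c.1| P1 P_le1 => [|[]].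
rewrite /colliding /code_parents; case xC: (collider_at c x).
  have parE : @parents (spider lam)
      (@rank_orient (spider lam) (code_rank c)) (Some x) =
      [set u | spider_edge (Some x) u].
    have above a p : a.+1 + 2 * false + p < a + 2 * true + p by lia.
    have below a p : a + 2 * false + p < a.+1 + 2 * true + p by lia.
    apply/setP => u; rewrite parents_spider [RHS]in_set.
    case xu: (spider_edge _ u) => //; rewrite /code_rank xC.
    case: u xu => [y|] //=; last by lia.
    case/andP=> /eqP xy; rewrite (same_side c xy) /consecutive /= => /orP[] /eqP yE.
      by rewrite (negbTE (collider_apart ok xC xy (esym yE))) -yE; exact: above.
    have yC : ~~ collider_at c y.
      by apply/negP => yC; move: (collider_apart ok yC (esym xy) (esym yE)); rewrite xC.
    by rewrite (negbTE yC) -yE; exact: below.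
  by rewrite parE card_nbrs // (collider_next ok).
rewrite ifF //; apply/negbTE; rewrite -leqNgt.
apply/card_le1_eqP => u w; rewrite !parents_spider /code_rank xC.
have not_above a b p : (a.+1 + 2 * b + p < a + 2 * false + p) = false by lia.
have below v : spider_edge (Some x) v -> 
    code_rank c v < tagged x + 2 * false + 2 * (tag x \notin c.1) ->
    (height v).+1 = height (Some x).
  case: v => [y|] //=; last by move/eqP ->.
  by case/andP=> /eqP/same_side -> /orP[] /eqP <- //; rewrite not_above.
move=> /andP[xu /(below u xu) hu] /andP[xw /(below w xw) hw].
exact: nbr_height_inj xw xu (succn_inj (etrans hw (esym hu))).
Qed.

(** Reading off the code of a DAG.  The constraints hold since a leg collider is
the head of both its edges: neither can an adjacent vertex be a collider too,
nor can its leg point to the center if it is the first vertex. *)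
Lemma code_of_rank (r : option leg_vertex -> nat) : @proper_rank (spider lam) r ->
  exists2 c, spider_code c &
    @colliding (spider lam) (@rank_orient (spider lam) r) =1 code_parents c.
Proof.
move=> pr; pose p u := @parents (spider lam) (@rank_orient (spider lam) r) u.
pose center := @colliding (spider lam) (@rank_orient (spider lam) r) None.
pose P := [set i | [exists x : leg_vertex, [&& tag x == i, tagged x == 0 :> nat & Some x \in center]]].
pose A := [ffun i => [set b : 'I_m.+1 |
  [exists x : leg_vertex, [&& tag x == i, tagged x == b :> nat & 1 < #|p (Some x)|]]]].
pose c : code := (P, A).
have collider_atE x : collider_at c x = (1 < #|p (Some x)|).
  rewrite /collider_at ffunE inE; apply/existsP/idP => [[y /and3P[/eqP yx /eqP yb]]|px].
    by rewrite (leg_vertex_eq yx) // yb inord_tagged.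
  by exists x; rewrite eqxx inord_tagged eqxx.
have codeA i b : b \in A i -> exists x, [/\ tag x = i, tagged x = b :> nat & collider_at c x].
  by rewrite ffunE inE => /existsP[x /and3P[/eqP ? /eqP ? ?]]; exists x; rewrite collider_atE.
have center_first x : Some x \in center -> tagged x = 0 :> nat.
  rewrite /center /colliding; case: ifP => [_|]; last by rewrite inE.
  by rewrite parents_spider => /andP[/eqP].
have centerE : center = code_parents c None.
  apply/setP => -[x|]; last first.
    rewrite [RHS](_ : _ = false); last by apply/negbTE/imsetP => -[].
    rewrite /center /colliding; case: ifP => _; last by rewrite inE.
    by rewrite parents_spider.
  rewrite mem_imset; last exact: Some_inj.
  rewrite !inE; apply/idP/andP => [xh|[/eqP x0 /existsP[y /and3P[/eqP yx /eqP y0]]]].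
    by rewrite center_first //; split=> //; apply/existsP; exists x; rewrite !eqxx center_first.
  by rewrite (leg_vertex_eq yx) // x0 y0.
have pos : P \subset [set i | 0 < lam i].
  apply/subsetP => i; rewrite !inE => /existsP[x /and3P[/eqP <- _ _]].
  exact: leq_ltn_trans (ltn_ord (tagged x)).
exists c; last first.
  move=> [x|]; last exact: centerE.
  rewrite /colliding /code_parents collider_atE -/(p _); case: ifP => // /parents_full[_ pE].
  exact: pE.
have full x u : collider_at c x -> spider_edge (Some x) u -> r u < r (Some x).
  rewrite collider_atE => /parents_full[_ pE] xu.
  have : u \in p (Some x) by rewrite /p pE inE.
  by rewrite parents_spider => /andP[].
apply/and3P; split=> //.
  have := @card_colliding (spider lam) (@rank_orient (spider lam) r) None; rewrite -/center centerE.
  by rewrite card_center_parents.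
apply/forallP => i; apply/andP; split.
  apply/leg_codeP => _ /codeA[x [<- <- xC]].
  move: (xC); rewrite collider_atE => /parents_full[lt_x _]; split=> // b /codeA[y [xy <- yC]] yE.
  have e : spider_edge (Some x) (Some y).
    by rewrite /= yE /consecutive /= eqxx andbT; apply/eqP.
  have := full _ _ xC e; have := full _ (Some x) yC; rewrite spider_edge_sym => /(_ e).
  by move/ltnW; rewrite leqNgt => /negbTE ->.
apply/implyP; rewrite inE => /existsP[x /and3P[/eqP xi /eqP x0 xh]].
apply/negP => /codeA[y [yi y0 yC]].
have yx : y = x by apply: leg_vertex_eq; rewrite ?yi ?xi ?y0 ?x0.
have := full _ None yC; rewrite /= yx x0 eqxx => /(_ isT).
move: xh; rewrite /center /colliding; case: ifP => _; last by rewrite inE.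
by rewrite parents_spider => /andP[_ /ltnW]; rewrite leqNgt => /negbTE ->.
Qed.

(** A collider is never the last vertex of its leg, so its recorded parent set
is nonempty and thus distinguishes it from a vertex that is no collider. *)
Lemma code_parents_inj : {in spider_code &, forall c d,
  code_parents c =1 code_parents d -> c = d}.
Proof.
have sub c d : spider_code c -> code_parents c =1 code_parents d ->
    c.1 \subset d.1 /\ forall i, c.2 i \subset d.2 i.
  move=> ok cd; split=> [|i]; apply/subsetP.
    move=> i iP; case/and3P: ok => _ /subsetP/(_ i iP) + _; rewrite inE => lam_i.
    have /setP/(_ (Some (at_leg lam_i))) := cd None.
    by rewrite !mem_imset ?inE /= ?iP //; exact: Some_inj.
  move=> b bA; have /leg_codeP/(_ b bA)[lt_b _] := spider_code_leg ok i.
  pose x := at_leg (ltnW lt_b).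
  have bE : inord b = b by apply: val_inj; rewrite /= inordK.
  have xC : collider_at c x by rewrite /collider_at /= bE.
  have := card_nbrs (collider_next ok xC); have := cd (Some x).
  rewrite /code_parents xC /collider_at /= bE; case: ifP => // _ ->; by rewrite cards0.
move=> [P A] [Q B] ok ok' cd.
have [PQ AB] := sub _ _ ok cd; have [QP BA] := sub _ _ ok' (fsym cd).
congr (_, _); first by apply/eqP; rewrite eqEsubset PQ.
by apply/ffunP => i; apply/eqP; rewrite eqEsubset AB BA.
Qed.

Lemma code_weight c : spider_code c ->
  \sum_v 'C(#|code_parents c v|, 2) = 'C(#|c.1|, 2) + \sum_i #|c.2 i|.
Proof.
move=> ok; rewrite (bigD1 None) //= card_center_parents; last by case/and3P: ok.
congr addn.
rewrite (reindex_omap (@Some leg_vertex) id) /=; last by case.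
rewrite (eq_bigl xpredT); last by move=> x; rewrite eqxx.
transitivity (\sum_x (collider_at c x : nat)).
  apply: eq_bigr => x _; case xC: (collider_at c x); last by rewrite cards0.
  by rewrite card_nbrs // (collider_next ok).
rewrite -(@sig_big_dep _ _ _ _ (fun i => 'I_(lam i)) xpredT (fun _ _ => true)
  (fun i a => (inord a \in c.2 i) : nat)) /=.
apply: eq_bigr => i _.
rewrite (big_ord_widen _ (fun a => (inord a \in c.2 i) : nat) (le_lam i)).
rewrite -sum1_card big_mkcond [RHS]big_mkcond /=; apply: eq_bigr => b _.
rewrite inord_val; case: ifP => [_|]; first by case: (b \in _).
case bA: (b \in c.2 i) => //.
by have /leg_codeP/(_ b bA)[/ltnW ->] := spider_code_leg ok i.
Qed.

Local Open Scope ring_scope.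

Definition free_leg (q : nat) : {poly int} :=
  \sum_(A | leg_code q A && (ord0 \notin A)) 'X^#|A|.

Definition blocked_leg (q : nat) : {poly int} :=
  \sum_(A | leg_code q A && (ord0 \in A)) 'X^#|A|.

(** For fixed P the collider sets of the legs are chosen independently, hence the
product. *)
Lemma mec_poly_spider : mec_poly (spider lam) =
  \sum_(P : {set 'I_k} | (#|P| != 1%N) && (P \subset [set i | (0 < lam i)%N]))
    'X^'C(#|P|, 2) *
    \prod_i ((if i \in P then 0 else blocked_leg (lam i)) + free_leg (lam i)).
Proof.
rewrite (@mec_poly_code (spider lam) _ spider_code code_parents); last first.
- by move=> c ok; exists (code_rank c); [exact: code_rank_proper | exact: parents_code].
- exact: code_of_rank.
- exact: code_parents_inj.
- exact: spider_triangle_free.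
pose ok (P : {set 'I_k}) i (B : {set 'I_m.+1}) := leg_code (lam i) B && ((i \in P) ==> (ord0 \notin B)).
transitivity (\sum_(P : {set 'I_k} | (#|P| != 1%N) && (P \subset [set i | (0 < lam i)%N]))
  \sum_(A : {ffun 'I_k -> {set 'I_m.+1}} | A \in family (ok P))
    'X^'C(#|P|, 2) * \prod_i 'X^#|A i| : {poly int}).
  rewrite pair_big_dep /=; apply: eq_big => [[P A]|[P A] cok] /=.
    by rewrite /spider_code /= -andbA.
  by rewrite code_weight // exprD; congr (_ * _); rewrite prodrXr.
apply: eq_bigr => P _; rewrite -big_distrr -(bigA_distr_big_dep (ok P) (fun _ A => 'X^#|A|)) /=.
congr (_ * _).
apply: eq_bigr => i _; rewrite /ok; case: ifP => _ /=.
  by rewrite add0r.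
rewrite (bigID (fun A : {set 'I_m.+1} => ord0 \in A)) /=; congr (_ + _).
  by apply: eq_bigl => A; rewrite andbT.
by apply: eq_bigl => A; rewrite andbT.
Qed.

End SpiderCodes.

(** * Recurrences for the legs *)

Section Legs.
Variable m : nat.
Implicit Types (A : {set 'I_m.+2}) (B : {set 'I_m.+1}).

Definition shift B : {set 'I_m.+2} := lift ord0 @: B.

Definition unshift A : {set 'I_m.+1} := lift ord0 @^-1: A.

Lemma mem_shift B b : (lift ord0 b \in shift B) = (b \in B).
Proof. by rewrite mem_imset //; apply: lift_inj. Qed.

Lemma ord0_shift B : ord0 \in shift B = false.
Proof. by apply/negbTE/imsetP => -[b _] /eqP; rewrite (negbTE (neq_lift _ _)). Qed.

Lemma shiftK : cancel shift unshift.
Proof. by move=> B; apply/setP => b; rewrite inE mem_shift. Qed.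

Lemma unshiftK A : ord0 \notin A -> shift (unshift A) = A.
Proof.
move=> A0; apply/setP => a; case: (unliftP ord0 a) => [b|] ->.
  by rewrite mem_shift inE.
by rewrite ord0_shift (negbTE A0).
Qed.

Lemma ord0_unshiftK A : ord0 \in A -> ord0 |: shift (unshift A) = A.
Proof.
move=> A0; apply/setP => a; rewrite inE in_set1; case: (unliftP ord0 a) => [b|] ->.
  by rewrite mem_shift inE eq_sym (negbTE (neq_lift _ _)).
by rewrite eqxx.
Qed.

Lemma ord0_shiftK B : unshift (ord0 |: shift B) = B.
Proof.
apply/setP => b; rewrite !inE eq_sym (negbTE (neq_lift _ _)).
exact: mem_shift.
Qed.

Lemma leg_code_shift q B : leg_code q.+1 (shift B) = leg_code q B.
Proof.
apply/leg_codeP/leg_codeP => ok.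
  move=> b bB; have := ok (lift ord0 b); rewrite mem_shift => /(_ bB)[lt nb].
  split=> [|c cB]; first by move: lt; rewrite lift0.
  by have := nb (lift ord0 c); rewrite mem_shift !lift0 => /(_ cB) cb cbE; apply: cb; rewrite cbE.
move=> _ /imsetP[b bB ->]; rewrite lift0; have [lt nb] := ok b bB.
split=> // _ /imsetP[c cB ->]; rewrite lift0 => -[]; exact: nb.
Qed.

Lemma leg_code_ord0_shift q B :
  leg_code q.+2 (ord0 |: shift B) = leg_code q.+1 B && (ord0 \notin B).
Proof.
apply/idP/andP => [/leg_codeP ok|[okB B0]].
  split; last first.
    apply/negP => B0; have [_ /(_ (lift ord0 ord0))] := ok ord0 (setU11 _ _).
    by rewrite !inE mem_shift B0 orbT lift0 => /(_ isT).
  rewrite -leg_code_shift; apply/leg_codeP => a aB.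
  have [lt nb] := ok a (setU1r _ aB); split=> // b bB; exact/nb/setU1r.
move: okB; rewrite -leg_code_shift => /leg_codeP ok.
apply/leg_codeP => a /setU1P[->|aB]; last first.
  have [lt nb] := ok a aB; split=> // b /setU1P[->|] //; exact: nb.
split=> // b /setU1P[-> //|/imsetP[c cB ->]]; rewrite lift0 => -[c0].
by move: B0; rewrite (_ : ord0 = c) ?cB //; apply: val_inj.
Qed.

Local Open Scope ring_scope.

(** If the first vertex of a leg is no collider, the rest carries an arbitrary
collider set of a leg with one vertex less. *)
Lemma free_legS q : free_leg m.+1 q.+1 = blocked_leg m q + free_leg m q.
Proof.
transitivity (\sum_(B : {set 'I_m.+1} | leg_code q B) 'X^#|B| : {poly int}); last first.
  by rewrite (bigID (fun B : {set 'I_m.+1} => ord0 \in B)).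
rewrite /free_leg (reindex_onto shift unshift) => [|A /andP[_]]; last exact: unshiftK.
apply: eq_big => B; first by rewrite leg_code_shift ord0_shift shiftK eqxx !andbT.
by rewrite card_imset //; apply: lift_inj.
Qed.

(** If the first vertex is a collider, the second is none, and what follows the
first vertex is again a leg whose first vertex is no collider. *)
Lemma blocked_legSS q : blocked_leg m.+1 q.+2 = 'X * free_leg m q.+1.
Proof.
rewrite /blocked_leg /free_leg big_distrr /=.
rewrite (reindex_onto (fun B => ord0 |: shift B) unshift) => [|A /andP[_]]; last first.
  exact: ord0_unshiftK.
apply: eq_big => B; first by rewrite leg_code_ord0_shift setU11 ord0_shiftK eqxx !andbT.
rewrite cardsU1 ord0_shift card_imset => [_|]; last exact: lift_inj.
by rewrite exprS.
Qed.

Lemma leg_code_le1 q B : (q <= 1)%N -> leg_code q B = (B == set0).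
Proof.
move=> q1; apply/leg_codeP/eqP => [ok|-> b]; last by rewrite inE.
apply/setP => b; rewrite inE; apply/negP => /ok[lt _]; by lia.
Qed.

Lemma free_leg1 : free_leg m 1 = 1.
Proof.
rewrite /free_leg (big_pred1 set0) ?cards0 // => B.
by rewrite leg_code_le1 //=; case: eqP => // ->; rewrite inE.
Qed.

Lemma blocked_leg1 : blocked_leg m 1 = 0.
Proof.
rewrite /blocked_leg big_pred0 // => B.
by rewrite leg_code_le1 //=; case: eqP => // ->; rewrite inE.
Qed.

End Legs.

(** * Paths, stars and the formula *)

(** An end vertex of a path is the center of a spider with a single leg; with at
most one neighbor it is no collider, so only the empty P remains. *)
Lemma mec_poly_path m q : q <= m.+1 ->
  mec_poly (path_graph q.+1) = (blocked_leg m q + free_leg m q)%R.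
Proof.
move=> le_q; pose lam (_ : 'I_1) := q.
pose phi (a : 'I_q.+1) : option {i : 'I_1 & 'I_(lam i)} :=
  omap (Tagged (fun i => 'I_(lam i))) (unlift ord0 a : option 'I_(lam ord0)).
pose psi (u : option {i : 'I_1 & 'I_(lam i)}) : 'I_q.+1 :=
  if u is Some x then lift ord0 (tagged x) else ord0.
have phiE (b : 'I_q) : phi (lift ord0 b) = Some (Tagged (fun i => 'I_(lam i)) (b : 'I_(lam ord0))).
  by rewrite /phi liftK.
have phi0 : phi ord0 = None by rewrite /phi unlift_none.
rewrite (@mec_poly_iso (path_graph q.+1) (spider lam) phi); first last.
- move=> a b; case: (unliftP ord0 a) => [c|] ->; case: (unliftP ord0 b) => [d|] ->.
  + by rewrite !phiE /= /consecutive /bump /= !add1n !eqSS.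
  + by rewrite phiE phi0 /= /consecutive /bump /= add1n eqSS.
  + by rewrite phiE phi0 /= /consecutive /bump /= add1n eqSS orbF eq_sym.
  + by rewrite phi0.
- exists psi => [a|[[i b]|]]; last exact: phi0.
    by case: (unliftP ord0 a) => [c|] ->; rewrite ?phiE ?phi0.
  by rewrite phiE (ord1 i).
- exact: spider_triangle_free.
rewrite (@mec_poly_spider _ _ m) //.
rewrite (big_pred1 set0) => [|P /=].
  by rewrite cards0 expr0 mul1r big_ord1 in_set0.
rewrite -cards_eq0; have: #|P| <= 1 by rewrite -[X in _ <= X]card_ord max_card.
case: (posnP #|P|) => [/cards0_eq -> _|].
  by rewrite cards0 sub0set.
by case: #|P| => [|[|]].
Qed.

Local Open Scope ring_scope.

(** The legs of size one have no colliders, so only the center contributes. *)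
Lemma mec_poly_star q : mec_poly (star_graph q) =
  \sum_(P : {set 'I_q} | #|P| != 1%N) 'X^'C(#|P|, 2).
Proof.
pose lam (_ : 'I_q) := 1%N.
pose leaf (i : 'I_q) : {i : 'I_q & 'I_(lam i)} :=
  @Tagged _ i (fun i => 'I_(lam i)) ord0.
rewrite (@mec_poly_iso (star_graph q) (spider lam) (omap leaf)); first last.
- by case=> [i|] [j|] //=; rewrite /consecutive /= andbF.
- exists (omap (@tag _ _)) => [[i|]|[[i b]|]] //=.
  by rewrite /leaf (ord1 b).
- exact: spider_triangle_free.
rewrite (@mec_poly_spider _ _ 0) //; apply: eq_big => P.
  by rewrite [_ \subset _](_ : _ = true) ?andbT //; apply/subsetP => i; rewrite inE.
move=> _; rewrite big1 ?mulr1 // => i _.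
by rewrite blocked_leg1 free_leg1 if_same add0r.
Qed.

Lemma sum_subset_card (R : nzSemiRingType) (T : finType) (B : {set T}) (g : nat -> R) :
  \sum_(P : {set T} | P \subset B) g #|P| = \sum_(p < #|B|.+1) g p *+ 'C(#|B|, p).
Proof.
have card_ltn (P : {set T}) : P \subset B -> (#|P| < #|B|.+1)%N.
  by rewrite ltnS; apply: subset_leq_card.
rewrite (partition_big (fun P : {set T} => inord #|P| : 'I_#|B|.+1) xpredT) //=.
apply: eq_bigr => p _; rewrite -cards_draws -sumr_const.
apply: eq_big => [P|P /andP[sub /eqP <-]]; last by rewrite inordK ?card_ltn.
rewrite inE; case sub: (P \subset B) => //=.
by rewrite -val_eqE /= inordK ?card_ltn.
Qed.

Lemma sum_star (T : finType) (B : {set T}) :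
  \sum_(P : {set T} | (P \subset B) && (#|P| != 1%N)) 'X^'C(#|P|, 2) =
  mec_poly (star_graph #|B|).
Proof.
pose g p : {poly int} := if p != 1%N then 'X^'C(p, 2) else 0.
rewrite mec_poly_star [RHS]big_mkcond big_mkcondr /=.
transitivity (\sum_(P : {set 'I_#|B|} | P \subset setT) g #|P|).
  by rewrite (sum_subset_card B g) (sum_subset_card setT g) cardsT card_ord.
by apply: eq_bigl => P; rewrite subsetT.
Qed.

(** As lam is weakly decreasing, this identifies the legs of size at least two
with the first k - l legs. *)
Lemma mem_downset k (D : {set 'I_k}) :
    (forall i j : 'I_k, (i <= j)%N -> j \in D -> i \in D) ->
  D = [set i : 'I_k | (i < #|D|)%N].
Proof.
move=> down; have card_lt (h : nat) : (h <= k)%N -> #|[set j : 'I_k | (j < h)%N]| = h.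
  move=> le_h; rewrite -sum1_card (eq_bigl (fun j : 'I_k => (j < h)%N)); last first.
    by move=> j; rewrite inE.
  by rewrite (big_ord_narrow le_h) sum1_card card_ord.
apply/setP => i; rewrite inE; apply/idP/idP => [iD|].
  rewrite -(card_lt i.+1) //; apply/subset_leq_card/subsetP => j.
  by rewrite inE ltnS => /down; apply.
apply: contraTT => iD; rewrite -leqNgt -(card_lt i (ltnW (ltn_ord i))).
apply/subset_leq_card/subsetP => j jD; rewrite inE ltnNge.
by apply: contra iD => /down; apply.
Qed.

Theorem theorem4p1 (n k : nat) (lam : 'I_k -> nat) (l : nat)
    (hk : (2 < k)%N)
    (hlam : is_partition lam (n - 1)%N)
    (hl : #|[set i : 'I_k | lam i == 1%N]| = l) :
  mec_poly (spider lam) =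
    \sum_(j < (k - l).+1)
      (\sum_(S : {set 'I_k} |
               (S \subset [set i : 'I_k | (i < k - l)%N]) && (#|S| == j))
          L lam S)
      * 'X^j * mec_poly (star_graph (k - j)%N).
Proof.
have [lam_dec lam_gt0 _] := hlam.
pose long := [set i | lam i != 1%N].
have card_long : #|long| = (k - l)%N.
  rewrite -hl -[k in (k - _)%N]card_ord -cardsT -cardsDS ?subsetT //.
  by congr #|pred_of_set _|; apply/setP => i; rewrite !inE andbT.
have longE : long = [set i : 'I_k | (i < k - l)%N].
  rewrite -card_long; apply: mem_downset => i j le_ij; rewrite !inE => j1.
  have := lam_dec i j le_ij; have := lam_gt0 j; move: j1; lia.
rewrite -longE.
pose m := (\max_i lam i)%N.
have le_lam i : (lam i <= m)%N by apply: (leq_bigmax i).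
have freeE i : free_leg m.+2 (lam i) = mec_poly (path_graph (lam i)).
  have := lam_gt0 i; have := le_lam i; case: (lam i) => // q le_q _.
  by rewrite (@mec_poly_path m.+1) ?free_legS //; lia.
have blockedE i : blocked_leg m.+2 (lam i) =
    if i \in long then 'X * mec_poly (path_graph (lam i - 1)) else 0.
  rewrite inE; have := lam_gt0 i; have := le_lam i.
  case: (lam i) => [//|[|q]] le_q _ /=; first exact: blocked_leg1.
  by rewrite subn1 blocked_legSS /= (@mec_poly_path m) ?free_legS //; lia.
rewrite (@mec_poly_spider _ _ m.+2); last by move=> i; have := le_lam i; lia.
transitivity (\sum_(S : {set 'I_k} | S \subset long)
   L lam S * 'X^#|S| * mec_poly (star_graph (k - #|S|))).
  (* w S P i is the factor of leg i for given P and S. *)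
  pose w (S P : {set 'I_k}) i := if i \in S
    then if i \in P then 0 else blocked_leg m.+2 (lam i)
    else free_leg m.+2 (lam i).
  transitivity (\sum_(P : {set 'I_k} | #|P| != 1%N) \sum_(S : {set 'I_k})
      'X^'C(#|P|, 2) * \prod_i w S P i).
    apply: eq_big => [P|P _]; last by rewrite -big_distrr bigA_distr.
    by rewrite [_ \subset _](_ : _ = true) ?andbT //; apply/subsetP => i; rewrite inE.
  rewrite exchange_big /= [RHS]big_mkcond; apply: eq_bigr => S _.
  (* The term vanishes unless S consists of long legs outside P. *)
  have wE P : \prod_i w S P i =
      if (S \subset long) && (P \subset ~: S) then L lam S * 'X^#|S| else 0.
    case: ifP => [/andP[/subsetP Sl PS]|].
      rewrite /L mulrAC -prodr_const -big_split /=.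
      rewrite (bigID (mem S)) /=; congr (_ * _); last first.
        by apply: eq_big => i; rewrite ?inE // /w => /negbTE ->; rewrite freeE.
      apply: eq_bigr => i iS; rewrite /w iS blockedE Sl // mulrC.
      case: ifP => // iP; by have := subsetP PS i iP; rewrite inE iS.
    move/negbT; rewrite negb_and => /orP[] /subsetPn[i].
      by move=> iS il; rewrite (bigD1 i) //= /w iS blockedE (negbTE il) if_same mul0r.
    by rewrite inE negbK => iP iS; rewrite (bigD1 i) //= /w iS iP mul0r.
  transitivity (\sum_(P : {set 'I_k} | #|P| != 1%N)
     if (S \subset long) && (P \subset ~: S) then 'X^'C(#|P|, 2) * (L lam S * 'X^#|S|) else 0).
    by apply: eq_bigr => P _; rewrite wE; case: ifP => // _; rewrite mulr0.
  case: (S \subset long) => /=; last by rewrite big1.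
  rewrite -big_mkcondr -big_distrl /= mulrC; congr (_ * _).
  rewrite (_ : (k - #|S|)%N = #|~: S|); last by rewrite (cardsCs (~: S)) setCK card_ord.
  by rewrite -sum_star; apply: eq_bigl => P; rewrite andbC.
rewrite (partition_big (fun S : {set 'I_k} => inord #|S| : 'I_(k - l).+1) xpredT) //=.
apply: eq_bigr => j _; rewrite -mulrA big_distrl /=.
have cardK (S : {set 'I_k}) : S \subset long -> (inord #|S| : 'I_(k - l).+1) = #|S| :> nat.
  by move=> sub; rewrite inordK // ltnS -card_long subset_leq_card.
apply: eq_big => [S|S /andP[sub /eqP <-]]; last by rewrite cardK // mulrA.
by case sub: (S \subset long) => //=; rewrite -val_eqE /= cardK.
Qed.
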